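(* Let $(X,g)$ be a multi-Eguchi--Hanson or a multi-Taub--NUT space with singular points $p_1,\dots,p_k$ of $\phi$, and let $r_i:=\sqrt{(p_i)_1^2+(p_i)_2^2}$, where $p_i=((p_i)_1,(p_i)_2,(p_i)_3)$. Then every compact minimal hypersurface of $X$ is contained in $$\pi^{-1}\Big(\{x\in \mathbb{R}^3: \sqrt{x_1^2+x_2^2}\le 2\max_i r_i\}\Big).$$ Moreover, there are no compact minimal hypersurfaces contained in $$\pi^{-1}\Big(\{x\in \mathbb{R}^3: \sqrt{x_1^2+x_2^2}<\min\{r_i: r_i>0\}\}\Big).$$
   Context: Multi-Eguchi--Hanson and multi-Taub--NUT spaces: let $p_1,\dots,p_k$ be distinct points of $\mathbb{R}^3$ ($k\ge 1$), let $m\ge 0$, let $U=\mathbb{R}^3\setminus\{p_1,\dots,p_k\}$, and let $\phi(x)=m+\sum_{i=1}^k \frac{1}{2|x-p_i|}$ on $U$. Let $\pi:X_0\to U$ be the principal $S^1$-bundle (with $S^1=\mathbb{R}/2\pi\mathbb{Z}$) carrying a connection $1$-form $\eta$ (that is, $\eta$ is $S^1$-invariant and $\eta(\xi)=1$, with $\xi$ the infinitesimal generator of the action) such that $d\eta=\pi^*( *_{\mathbb{R}^3}d\phi)$, and put $g=\phi^{-1}\eta^2+\phi\,\pi^*g_{\mathbb{R}^3}$. Adding one point over each $p_i$ yields a smooth complete hyperkähler $4$-manifold $(X,g)$ to which the $S^1$-action extends (fixing the added points), and $\pi$ extends to $\pi:X\to\mathbb{R}^3$. It is called a multi-Eguchi--Hanson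 space if $m=0$ and a multi-Taub--NUT space if $m>0$; the $p_i$ are called the singular points of $\phi$. A hypersurface is a $3$-dimensional submanifold without boundary; minimal means vanishing mean curvature vector. The minimum of the empty set is $+\infty$. *)

(* Defs.v *)
From HB Require Import structures.
From mathcomp Require Import all_boot all_order all_algebra.
From mathcomp Require Import all_classical all_reals all_analysis.

Set Implicit Arguments.
Unset Strict Implicit.
Unset Printing Implicit Defensive.

Import Order.TTheory GRing.Theory Num.Theory.
Import numFieldNormedType.Exports.

Local Open Scope classical_set_scope.
Local Open Scope ring_scope.

(* Vectors and covectors are row vectors.  With the library's [jacobian],
   (jacobian f u) i j is the i-th partial derivative of the j-th component of
   f, and the differential is v |-> v *m jacobian f u.  Hence covectors pull
   back by a |-> a *m J^T and bilinear forms by B |-> J *m B *m J^T. *)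

(* ------------------------------------------------------------------------ *)
(* Smooth functions between (finite-dimensional) normed spaces.  These are
   only used with D open. *)

Fixpoint Ck_on (R : realType) (V W : normedModType R) (k : nat) (D : set V)
    (f : V -> W) : Prop :=
  match k with
  | 0%N => forall u, D u -> {for u, continuous f}
  | j.+1 => (forall u, D u -> differentiable f u) /\
            (forall v : V, Ck_on j D (fun u => 'D_v f u))
  end.

Definition smooth_on (R : realType) (V W : normedModType R) (D : set V)
    (f : V -> W) : Prop :=
  forall k, Ck_on k D f.

Definition partial (R : realType) (n : nat) (i : 'I_n) (f : 'rV[R]_n -> R)
    (u : 'rV[R]_n) : R :=
  'D_(delta_mx 0 i : 'rV[R]_n) f u.

(* ------------------------------------------------------------------------ *)
(* Smooth manifolds. *)

(* [cinv] is only meaningful on the image of [cdom], [cmap] only on [cdom]. *)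
Record chart (R : realType) (T : topologicalType) (n : nat) := Chart {
  cdom : set T;
  cmap : T -> 'rV[R]_n;
  cinv : 'rV[R]_n -> T;
  open_cdom : open cdom;
  open_ccod : open (cmap @` cdom);
  cmapK : forall x, cdom x -> cinv (cmap x) = x;
  cmap_cont : forall x, cdom x -> {for x, continuous cmap};
  cinv_cont : forall u, (cmap @` cdom) u -> {for u, continuous cinv}
}.

Definition ccod (R : realType) (T : topologicalType) (n : nat)
    (c : chart R T n) : set 'rV[R]_n :=
  cmap c @` cdom c.

Definition local_rep (R : realType) (T : topologicalType) (n : nat)
    (c c' : chart R T n) (F : T -> T) : 'rV[R]_n -> 'rV[R]_n :=
  fun u => cmap c' (F (cinv c u)).

Definition compatible (R : realType) (T : topologicalType) (n : nat)
    (c c' : chart R T n) : Prop :=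
  smooth_on (cmap c @` (cdom c `&` cdom c')) (local_rep c c' id) /\
  smooth_on (cmap c' @` (cdom c `&` cdom c')) (local_rep c' c id).

Record smooth_manifold (R : realType) (n : nat) := SmoothManifold {
  mcarrier :> topologicalType;
  atlas : set (chart R mcarrier n);
  mfd_hausdorff : hausdorff_space mcarrier;
  mfd_second_countable : @second_countable mcarrier;
  atlas_cover : forall x : mcarrier, exists2 c, atlas c & cdom c x;
  atlas_compatible : forall c c', atlas c -> atlas c' -> compatible c c';
  atlas_maximal : forall c,
    (forall c', atlas c' -> compatible c c') -> atlas c
}.

(* Smoothness on the open set O of a map from a manifold to a vector space. *)
Definition smooth_from (R : realType) (n : nat) (X : smooth_manifold R n)
    (W : normedModType R) (O : set X) (f : X -> W) : Prop :=
  forall c, atlas c ->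
    smooth_on (cmap c @` (cdom c `&` O)) (fun u => f (cinv c u)).

(* Smoothness on the open set D of a map from a vector space to a manifold. *)
Definition smooth_into (R : realType) (n : nat) (X : smooth_manifold R n)
    (E : normedModType R) (D : set E) (F : E -> X) : Prop :=
  (forall z, D z -> {for z, continuous F}) /\
  (forall c, atlas c ->
     smooth_on (D `&` F @^-1` cdom c) (fun z => cmap c (F z))).

(* ------------------------------------------------------------------------ *)
(* Tensor fields, given by their components in every chart of the atlas. *)

(* F^* eta = eta on O. *)
Definition preserves_oneform (R : realType) (n : nat) (X : smooth_manifold R n)
    (O : set X) (eta : chart R X n -> 'rV[R]_n -> 'rV[R]_n) (F : X -> X) :
    Prop :=
  forall c c' x, atlas c -> atlas c' -> O x -> cdom c x -> cdom c' (F x) ->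
    eta c (cmap c x) =
      eta c' (cmap c' (F x)) *m (jacobian (local_rep c c' F) (cmap c x))^T.

(* With F = id, [preserves_oneform] is the law of change of coordinates. *)
Record is_oneform (R : realType) (n : nat) (X : smooth_manifold R n)
    (O : set X) (eta : chart R X n -> 'rV[R]_n -> 'rV[R]_n) : Prop := {
  oneform_smooth : forall c, atlas c ->
    smooth_on (cmap c @` (cdom c `&` O)) (eta c);
  oneform_change : preserves_oneform O eta id
}.

(* Components of the exterior derivative of the 1-form with components [a];
   the 2-form w is encoded by the skew matrix of the w(e_i, e_j). *)
Definition ext_d (R : realType) (n : nat) (a : 'rV[R]_n -> 'rV[R]_n)
    (u : 'rV[R]_n) : 'M[R]_n :=
  \matrix_(i, j) (partial i (fun v => a v 0 j) u -
                  partial j (fun v => a v 0 i) u).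

Record riemannian_metric (R : realType) (n : nat) (X : smooth_manifold R n) :=
  RiemannianMetric {
  gmx :> chart R X n -> 'rV[R]_n -> 'M[R]_n;
  gmx_smooth : forall c, atlas c -> smooth_on (ccod c) (gmx c);
  gmx_sym : forall c u, atlas c -> ccod c u -> (gmx c u)^T = gmx c u;
  gmx_pos : forall c u, atlas c -> ccod c u ->
    forall v : 'rV[R]_n, v != 0 -> 0 < (v *m gmx c u *m v^T) 0 0;
  gmx_change : forall c c' x, atlas c -> atlas c' -> cdom c x -> cdom c' x ->
    let J := jacobian (local_rep c c' id) (cmap c x) in
    gmx c (cmap c x) = J *m gmx c' (cmap c' x) *m J^T
}.

(* ------------------------------------------------------------------------ *)
(* Hypersurfaces and mean curvature. *)

Definition slice_chart (R : realType) (n : nat) (X : smooth_manifold R n.+1)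
    (S : set X) (c : chart R X n.+1) : Prop :=
  atlas c /\ forall x, cdom c x -> (S x <-> cmap c x 0 ord_max = 0).

Definition hypersurface (R : realType) (n : nat) (X : smooth_manifold R n.+1)
    (S : set X) : Prop :=
  forall x, S x -> exists2 c, slice_chart S c & cdom c x.

(* The vector nabla_{e_i} e_j, for the Levi-Civita connection nabla of the
   metric with components [g]. *)
Definition christoffel (R : realType) (n : nat) (g : 'rV[R]_n -> 'M[R]_n)
    (u : 'rV[R]_n) (i j : 'I_n) : 'rV[R]_n :=
  \row_k (2^-1 * \sum_l invmx (g u) k l *
    (partial i (fun v => g v j l) u + partial j (fun v => g v i l) u
     - partial l (fun v => g v i j) u)).

Section SliceCurvature.
(* Geometry of {u | u_n = 0} in 'rV_n.+1 with the metric [g]; the tangent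
   space is spanned by the first n basis vectors. *)
Variables (R : realType) (n : nat).
Variables (g : 'rV[R]_n.+1 -> 'M[R]_n.+1) (u : 'rV[R]_n.+1).

Definition tangent_vec (a : 'I_n) : 'rV[R]_n.+1 := delta_mx 0 (lift ord_max a).

Definition induced_metric : 'M[R]_n :=
  \matrix_(a, b) g u (lift ord_max a) (lift ord_max b).

Definition normal_part (v : 'rV[R]_n.+1) : 'rV[R]_n.+1 :=
  v - \sum_a \sum_b
        (invmx induced_metric a b * (v *m g u *m (tangent_vec a)^T) 0 0)
          *: tangent_vec b.

Definition second_fundamental_form (a b : 'I_n) : 'rV[R]_n.+1 :=
  normal_part (christoffel g u (lift ord_max a) (lift ord_max b)).

Definition mean_curvature : 'rV[R]_n.+1 :=
  \sum_a \sum_b invmx induced_metric a b *: second_fundamental_form a b.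

End SliceCurvature.

Definition minimal_hypersurface (R : realType) (n : nat)
    (X : smooth_manifold R n.+1) (g : riemannian_metric X) (S : set X) : Prop :=
  hypersurface S /\
  forall c x, slice_chart S c -> S x -> cdom c x ->
    mean_curvature (g c) (cmap c x) = 0.

(* ------------------------------------------------------------------------ *)
(* The Gibbons-Hawking ansatz. *)

(* The norm of the library on 'rV[R]_3 is the sup norm. *)
Definition enorm (R : realType) (n : nat) (v : 'rV[R]_n) : R :=
  Num.sqrt (\sum_i v 0 i ^+ 2).

Definition gh_potential (R : realType) (k : nat) (p : 'I_k -> 'rV[R]_3) (m : R)
    (x : 'rV[R]_3) : R :=
  m + \sum_i (2 * enorm (x - p i))^-1.

Definition regular_pts (R : realType) (k : nat) (p : 'I_k -> 'rV[R]_3) :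
    set 'rV[R]_3 :=
  [set x | forall i, x != p i].

Definition covector_d (R : realType) (n : nat) (f : 'rV[R]_n -> R)
    (x : 'rV[R]_n) : 'rV[R]_n :=
  \row_i partial i f x.

(* The Hodge star from 1-forms to 2-forms on oriented Euclidean 3-space;
   indices are added modulo 3. *)
Definition hodge3 (R : realType) (a : 'rV[R]_3) : 'M[R]_3 :=
  \matrix_(i, j) (if j == i + 1 then a 0 (i + 2)
                  else if i == j + 1 then - a 0 (j + 2) else 0).

Definition circle_angle (R : realType) (t : R) : Prop :=
  exists z : int, t = z%:~R * (2 * pi).

(* The circle R / 2 pi Z acts through its universal cover R. *)
Record gh_space (R : realType) (k : nat) (p : 'I_k -> 'rV[R]_3) (m : R) :=
  GHSpace {
  gh_mfd :> smooth_manifold R 4;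
  gh_metric : riemannian_metric gh_mfd;
  gh_proj : gh_mfd -> 'rV[R]_3;
  gh_act : R -> gh_mfd -> gh_mfd;
  gh_eta : chart R gh_mfd 4 -> 'rV[R]_4 -> 'rV[R]_4;

  gh_npts : (0 < k)%N;
  gh_distinct : injective p;
  gh_mass : 0 <= m;

  gh_act0 : forall x, gh_act 0 x = x;
  gh_actD : forall s t x, gh_act (s + t) x = gh_act s (gh_act t x);
  gh_act_period : forall x, gh_act (2 * pi) x = x;
  gh_act_smooth : forall c, atlas c ->
    smooth_into [set z : R * 'rV[R]_4 | ccod c z.2]
                (fun z => gh_act z.1 (cinv c z.2));

  gh_proj_smooth : smooth_from setT gh_proj;
  gh_proj_act : forall t x, gh_proj (gh_act t x) = gh_proj x;

  (* gh_proj is a principal circle bundle over regular_pts p: the action is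
     free there, and every b has a neighbourhood V with an equivariant
     diffeomorphism from V * (R / 2 pi Z) onto its preimage, induced by T;
     the inverse is locally (gh_proj, theta) with theta a lift to R of its
     second component. *)
  gh_free : forall t x, regular_pts p (gh_proj x) -> gh_act t x = x ->
    circle_angle t;
  gh_trivial : forall b, regular_pts p b ->
    exists (V : set 'rV[R]_3) (T : 'rV[R]_3 * R -> gh_mfd),
      [/\ [/\ open V, V b & V `<=` regular_pts p],
          smooth_into [set z | V z.1] T,
          forall y t, V y -> gh_proj (T (y, t)) = y,
          forall y s t, V y -> T (y, s + t) = gh_act s (T (y, t)) &
          forall x, V (gh_proj x) ->
            exists (O : set gh_mfd) (theta : gh_mfd -> R),
              [/\ open O, O x, smooth_from O theta &
                  forall x', O x' ->
                    V (gh_proj x') /\ T (gh_proj x', theta x') = x']];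

  (* exactly one point is added over each p i *)
  gh_added : forall i, exists! x, gh_proj x = p i;

  (* gh_eta is a connection form *)
  gh_eta_oneform : is_oneform (gh_proj @^-1` regular_pts p) gh_eta;
  gh_eta_invariant : forall t,
    preserves_oneform (gh_proj @^-1` regular_pts p) gh_eta (gh_act t);
  gh_eta_generator : forall c x, atlas c -> cdom c x ->
    regular_pts p (gh_proj x) ->
    let xi := derive1 (fun t : R => cmap c (gh_act t x)) 0 in
    (xi *m (gh_eta c (cmap c x))^T) 0 0 = 1;

  gh_curvature : forall c x, atlas c -> cdom c x ->
    regular_pts p (gh_proj x) ->
    let J := jacobian (fun u => gh_proj (cinv c u)) (cmap c x) in
    ext_d (gh_eta c) (cmap c x) =
      J *m hodge3 (covector_d (gh_potential p m) (gh_proj x)) *m J^T;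

  gh_metricE : forall c x, atlas c -> cdom c x ->
    regular_pts p (gh_proj x) ->
    let phi := gh_potential p m (gh_proj x) in
    let eta := gh_eta c (cmap c x) in
    let J := jacobian (fun u => gh_proj (cinv c u)) (cmap c x) in
    gh_metric c (cmap c x) = phi^-1 *: (eta^T *m eta) + phi *: (J *m J^T)
}.

Definition multi_Eguchi_Hanson (R : realType) (k : nat)
    (p : 'I_k -> 'rV[R]_3) (m : R) (X : gh_space p m) : Prop := m = 0.

Definition multi_Taub_NUT (R : realType) (k : nat)
    (p : 'I_k -> 'rV[R]_3) (m : R) (X : gh_space p m) : Prop := 0 < m.

Definition compact_minimal_hypersurface (R : realType) (k : nat)
    (p : 'I_k -> 'rV[R]_3) (m : R) (X : gh_space p m) (S : set X) : Prop :=
  [/\ S !=set0, compact S & minimal_hypersurface (gh_metric X) S].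

Definition axis_dist (R : realType) (x : 'rV[R]_3) : R :=
  Num.sqrt (x 0 0 ^+ 2 + x 0 1 ^+ 2).

(* Main.v *)
Require Import Defs.
From HB Require Import structures.
From mathcomp Require Import all_boot all_order all_algebra.
From mathcomp Require Import all_classical all_reals all_analysis.
From mathcomp Require Import ring lra.

Set Implicit Arguments.
Unset Strict Implicit.
Unset Printing Implicit Defensive.

Import Order.TTheory GRing.Theory Num.Theory.
Import numFieldNormedType.Exports.

Local Open Scope classical_set_scope.
Local Open Scope ring_scope.

(* Let rho be the distance to the x_3-axis and y a point of the compact minimal
   hypersurface S at which rho o pi is maximal.  If rho(y) > 0 and pi(y) is not
   a singular point, then S is tangent at y to the cylinder {rho = rho(y)} and
   lies inside it.  The trace of the Hessian of rho^2 over that tangent space,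
   spanned by the vertical, the angular and the axial direction, is
   phi^-1 (2 + rho phi_rho / phi); minimality and the second derivative test
   make it nonpositive.  But it is positive as soon as
   rho <x - p_i, d_rho> < 2 |x - p_i|^2 for all i, which holds if rho > 2 r_i,
   and also if r_i = 0 or rho < r_i.  Finally rho cannot vanish on all of S,
   since the preimage of the axis is only two-dimensional. *)

(** * Differential calculus along directions *)

Lemma is_derive_line (R : realType) (V W : normedModType R) (f : V -> W)
    (u v : V) (t : R) (df : W) :
  is_derive (t *: v + u) v f df ->
  is_derive t 1 (fun s : R => f (s *: v + u)) df.
Proof.
case=> + <-; rewrite /derivable => df'.
have E : (fun h : R => h^-1 *: (((fun s : R => f (s *: v + u)) \o shift t) (h *: 1)
           - f (t *: v + u))) =
         (fun h : R => h^-1 *: ((f \o shift (t *: v + u)) (h *: v)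
           - f (t *: v + u))).
  by apply/funext => h /=; rewrite [h *: 1]mulr1 scalerDl addrA.
by apply: DeriveDef; rewrite /derivable /derive E.
Qed.

(** The mean value theorem is applied twice: in the direction [v] to the difference of [f] on two
    parallel segments, then in the direction [w] to [f1]. Derivatives are required only on a closed
    parallelogram, which fits into any neighbourhood of [u] once [s] is small. *)
Lemma mixed_difference (R : realType) (V : normedModType R)
    (f f1 f2 : V -> R) (u v w : V) (s : R) :
  0 < s ->
  (forall a b : R, 0 <= a <= s -> 0 <= b <= s ->
     is_derive (a *: v + (b *: w + u)) v f (f1 (a *: v + (b *: w + u))) /\
     is_derive (a *: v + (b *: w + u)) w f1 (f2 (a *: v + (b *: w + u)))) ->
  exists c d : R, [/\ 0 <= c <= s, 0 <= d <= s &
    f (s *: v + (s *: w + u)) - f (s *: w + u) - (f (s *: v + u) - f u) =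
    s * s * f2 (c *: v + (d *: w + u))].
Proof.
move=> s0 df.
have s0' := ltW s0.
pose h (t : R) := f (t *: v + (s *: w + u)) - f (t *: v + u).
pose dh (t : R) := f1 (t *: v + (s *: w + u)) - f1 (t *: v + u).
have hdh t : 0 <= t <= s -> is_derive t 1 h (dh t).
  move=> ts; apply: is_deriveB; apply: is_derive_line.
    by apply: (df t s _ _).1; rewrite ?s0' ?lexx.
  rewrite -[X in _ + X]add0r -(scale0r w); apply: (df t 0 _ _).1; rewrite ?ts //.
  by rewrite lexx s0'.
have [c cs hc] : exists2 c, c \in `]0, s[%R & h s - h 0 = dh c * (s - 0).
  apply: (@MVT R h dh) s0 _ _.
    by move=> x /[!in_itv]/= /andP[x0 xs]; apply: hdh; rewrite !ltW.
  apply: derivable_within_continuous => x /[!in_itv]/= xs.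
  by have [] := hdh x xs.
move: cs; rewrite in_itv /= => /andP[c0 cs].
have cs' : 0 <= c <= s by rewrite !ltW.
pose k (t : R) := f1 (t *: w + (c *: v + u)).
pose dk (t : R) := f2 (t *: w + (c *: v + u)).
have kdk t : 0 <= t <= s -> is_derive t 1 k (dk t).
  by move=> ts; apply: is_derive_line; rewrite /dk addrCA; apply: (df c t _ _).2.
have [d ds kd] : exists2 d, d \in `]0, s[%R & k s - k 0 = dk d * (s - 0).
  apply: (@MVT R k dk) s0 _ _.
    by move=> x /[!in_itv]/= /andP[x0 xs]; apply: kdk; rewrite !ltW.
  apply: derivable_within_continuous => x /[!in_itv]/= xs.
  by have [] := kdk x xs.
move: ds; rewrite in_itv /= => /andP[d0 ds].
exists c, d; split; [by []|by rewrite !ltW|].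
move: kd hc; rewrite /k /dk /h /dh !subr0 !scale0r !add0r => kd hc.
rewrite ![_ *: w + (c *: v + u)]addrCA in kd.
transitivity (f (s *: v + (s *: w + u)) - f (s *: v + u) -
  (f (s *: w + u) - f u)); first by ring.
by rewrite hc kd; ring.
Qed.

Lemma near_cube (R : realType) (V : normedModType R) (u v w : V) (D : set V) :
  nbhs u D ->
  exists2 s : R, 0 < s & forall a b : R, 0 <= a <= s -> 0 <= b <= s ->
    D (a *: v + (b *: w + u)).
Proof.
move=> /nbhs_ballP[e /= e0 De].
(* The added 1 keeps the denominator positive when [v] and [w] vanish, and makes the final bound
   strict. *)
pose s := e / (`|v| + `|w| + 1).
have N0 : 0 < `|v| + `|w| + 1 by rewrite ltr_wpDl // addr_ge0.
have s0 : 0 < s by rewrite divr_gt0.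
exists s => // a b /andP[a0 as_] /andP[b0 bs]; apply: De.
rewrite -ball_normE /= addrA opprD addrCA subrr addr0 normrN.
apply: le_lt_trans (ler_normD _ _) _.
rewrite !normrZ (ger0_norm a0) (ger0_norm b0).
apply: (@le_lt_trans _ _ (s * (`|v| + `|w|))).
  by rewrite mulrDr lerD // ler_wpM2r.
by rewrite /s mulrAC ltr_pdivrMr // ltr_pM2l // ltrDl.
Qed.

(* Both mixed derivatives are limits of the same second mixed difference
   quotient. *)
Lemma is_derive_comm (R : realType) (V : normedModType R)
    (f fv fw fvw fwv : V -> R) (u v w : V) :
  (\forall z \near u, is_derive z v f (fv z) /\ is_derive z w f (fw z)) ->
  (\forall z \near u, is_derive z w fv (fvw z) /\ is_derive z v fw (fwv z)) ->
  {for u, continuous fvw} -> {for u, continuous fwv} ->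
  fvw u = fwv u.
Proof.
move=> d1 d2 /cvgrPdist_lt c1 /cvgrPdist_lt c2; apply/eqP/negPn/negP => neq.
set A := fvw u in neq c1 *; set B := fwv u in neq c2 *.
(* Near [u] each mixed derivative stays within half the gap of its value at [u]. The two agree at
   suitable points of the parallelogram, so the triangle inequality closes the gap. *)
have e0 : 0 < `|A - B| / 2 by rewrite divr_gt0 ?normr_gt0 ?subr_eq0.
have [s s0 Ds] := near_cube v w (filterI (filterI d1 d2)
  (filterI (c1 _ e0) (c2 _ e0))).
have [a [b [ha hb E1]]] : exists a b : R, [/\ 0 <= a <= s, 0 <= b <= s &
    f (s *: v + (s *: w + u)) - f (s *: w + u) - (f (s *: v + u) - f u) =
    s * s * fvw (a *: v + (b *: w + u))].
  apply: (mixed_difference (f1 := fv) s0) => x y hx hy.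
  by have [[[? _] [? _]] _] := Ds x y hx hy.
have [c [d [hc hd E2]]] : exists c d : R, [/\ 0 <= c <= s, 0 <= d <= s &
    f (s *: w + (s *: v + u)) - f (s *: v + u) - (f (s *: w + u) - f u) =
    s * s * fwv (c *: w + (d *: v + u))].
  apply: (mixed_difference (f1 := fw) s0) => x y hx hy; rewrite addrCA.
  by have [[[_ ?] [_ ?]] _] := Ds y x hy hx.
have [_ [/= l1 _]] := Ds _ _ ha hb.
have [_ [_ /= l2]] := Ds _ _ hd hc.
have E : fvw (a *: v + (b *: w + u)) = fwv (d *: v + (c *: w + u)).
  apply: (@mulfI _ (s * s)); first by rewrite mulf_neq0 // gt_eqF.
  by rewrite -E1 [d *: v + _]addrCA -E2 [s *: w + (s *: v + u)]addrCA; ring.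
rewrite E distrC in l1.
have := ltrD l1 l2; rewrite -splitr distrC [X in _ + X]distrC.
by move=> /(le_lt_trans (ler_distD _ _ _)); rewrite ltxx.
Qed.

(** * First and second derivative tests along a line *)

Lemma near_line (R : realType) (V : normedModType R) (u v : V) (D : set V) :
  nbhs u D -> \forall t \near (0 : R), D (t *: v + u).
Proof.
move=> Du; have : (fun t : R => t *: v + u) @ (0 : R) --> 0 *: v + u.
  by apply: cvgD; [apply: cvgZr_tmp; exact: cvg_id | exact: cvg_cst].
by rewrite scale0r add0r => /(_ _ Du).
Qed.

Lemma line_max_derive (R : realType) (V : normedModType R) (f f1 : V -> R)
    (u v : V) :
  (\forall z \near u, is_derive z v f (f1 z)) ->
  (\forall t \near (0 : R), f (t *: v + u) <= f u) -> f1 u = 0.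
Proof.
move=> df nf.
have /nbhs_ballP[e /= e0 De] : nbhs (0 : R)
    [set t | is_derive (t *: v + u) v f (f1 (t *: v + u)) /\
             f (t *: v + u) <= f u].
  exact: filterI (near_line v df) nf.
have De' t : t \in `](- e), e[%R -> ball (0 : R) e t.
  by rewrite in_itv /= -ball_normE /= sub0r normrN ltr_norml.
have u0 := is_derive_line (De 0 (ballxx _ e0)).1.
have D0 : is_derive (0 : R) 1 (fun t => f (t *: v + u)) 0.
  apply: (@derive1_at_max R _ (- e) e 0).
  - by lra.
  - by move=> t /De'/De[/is_derive_line[]].
  - by rewrite in_itv /= oppr_lt0 e0.
  - by move=> t /De'/De[_]; rewrite scale0r add0r.
have := @derive_val _ _ _ _ _ _ _ u0.
by rewrite (@derive_val _ _ _ _ _ _ _ D0) scale0r add0r.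
Qed.

(** As [f1] vanishes at the maximum, [f2 > 0] would make [f1] positive just after it; by the mean
    value theorem [f] would then exceed its maximum. *)
Lemma line_max_derive2 (R : realType) (V : normedModType R) (f f1 : V -> R)
    (f2 : R) (u v : V) :
  (\forall z \near u, is_derive z v f (f1 z)) -> is_derive u v f1 f2 ->
  (\forall t \near (0 : R), f (t *: v + u) <= f u) -> f2 <= 0.
Proof.
move=> df d2f nf; rewrite leNgt; apply/negP => pos.
have d0 := line_max_derive df nf.
have : (fun t : R => t^-1 *: (f1 (t *: v + u) - f1 u)) @ 0^' --> f2.
  by case: d2f => + <-; exact: id.
move=> /cvgrPdist_lt /(_ _ pos) near_pos.
have /nbhs_ballP[e /= e0 De] : nbhs (0 : R)
    [set t | is_derive (t *: v + u) v f (f1 (t *: v + u)) /\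
       (f (t *: v + u) <= f u /\
        (t != 0 -> `|f2 - t^-1 *: (f1 (t *: v + u) - f1 u)| < f2))].
  exact: filterI (near_line v df) (filterI nf near_pos).
have e2 : 0 < e / 2 by lra.
have De' t : 0 <= t <= e / 2 -> ball (0 : R) e t.
  by move=> /andP[t0 te]; rewrite -ball_normE /= sub0r normrN ger0_norm; lra.
have df' x : 0 <= x <= e / 2 ->
    is_derive x 1 (fun t => f (t *: v + u)) (f1 (x *: v + u)).
  by move=> xs; apply: is_derive_line; apply: (De x _).1; apply: De'.
have [c ce hc] : exists2 c, c \in `]0, (e / 2)[%R &
   f ((e / 2) *: v + u) - f (0 *: v + u) = f1 (c *: v + u) * (e / 2 - 0).
  apply: (@MVT R (fun t => f (t *: v + u)) (fun t => f1 (t *: v + u)) _ _ e2 _ _).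
    by move=> x /[!in_itv]/= /andP[x0 xs]; apply: df'; rewrite !ltW.
  apply: derivable_within_continuous => x /[!in_itv]/= xs.
  by have [] := df' x xs.
move: ce; rewrite in_itv /= => /andP[c0 ce].
have cs : 0 <= c <= e / 2 by rewrite !ltW.
have hd : 0 < f1 (c *: v + u).
  have [_ [_ /= /(_ (lt0r_neq0 c0))]] := De c (De' c cs).
  rewrite d0 subr0 ltr_norml => /andP[_]; rewrite ltrBlDr ltrDl.
  by rewrite /GRing.scale /= pmulr_rgt0 // invr_gt0.
have [_ [/= le_f _]] := De (e / 2) (De' (e / 2) ltac:(by rewrite lexx ltW)).
move: hc; rewrite scale0r add0r subr0 => hc.
have : 0 < f ((e / 2) *: v + u) - f u by rewrite hc mulr_gt0.
by rewrite subr_gt0 ltNge le_f.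
Qed.

(** * Differentiation rules and the derivative of the potential *)

Lemma is_derive_coord (R : realType) (V : normedModType R) m n
    (F : V -> 'M[R]_(m, n)) (u v : V) (dF : 'M[R]_(m, n)) i j :
  is_derive u v F dF -> is_derive u v (fun z => F z i j) (dF i j).
Proof.
case=> dd <-; apply: DeriveDef; first exact: (derivable_mxP F u v).1.
by rewrite (derive_mx dd) mxE.
Qed.

Lemma is_derive_fmul (R : realType) (V : normedModType R) (f g : V -> R)
    (u v : V) (df dg : R) :
  is_derive u v f df -> is_derive u v g dg ->
  is_derive u v (fun z => f z * g z) (f u * dg + g u * df).
Proof. exact: is_deriveM. Qed.

Lemma is_derive_fadd (R : realType) (V : normedModType R) (f g : V -> R)
    (u v : V) (df dg : R) :
  is_derive u v f df -> is_derive u v g dg ->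
  is_derive u v (fun z => f z + g z) (df + dg).
Proof. exact: is_deriveD. Qed.

Lemma is_derive_finv (R : realType) (V : normedModType R) (f : V -> R)
    (u v : V) (df : R) :
  f u != 0 -> is_derive u v f df ->
  is_derive u v (fun z => (f z)^-1) (- (f u) ^- 2 * df).
Proof.
move=> f0 [dd <-]; apply: DeriveDef; first exact: derivableV.
exact: deriveV.
Qed.

Lemma is_derive_fsum (R : realType) (V : normedModType R) (I : finType)
    (f : I -> V -> R) (u v : V) (df : I -> R) :
  (forall i, is_derive u v (f i) (df i)) ->
  is_derive u v (fun z => \sum_i f i z) (\sum_i df i).
Proof.
move=> fd; elim: (index_enum I) => [|a l IH].
  rewrite big_nil (_ : (fun z => _) = cst 0); first exact: is_derive_cst.
  by apply/funext => z; rewrite big_nil.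
rewrite big_cons.
rewrite (_ : (fun z => _) = (fun z => f a z + \sum_(i <- l) f i z)).
  exact: is_derive_fadd.
by apply/funext => z; rewrite big_cons.
Qed.

Lemma is_derive_fscale (R : realType) (V : normedModType R) (f : V -> R)
    (u v : V) (a df : R) :
  is_derive u v f df -> is_derive u v (fun z => a * f z) (a * df).
Proof. exact: is_deriveZ. Qed.

(** Converse of [is_derive_line] at the parameter 0; it reduces the chain rule below to one real
    variable. *)
Lemma is_derive_line0 (R : realType) (V W : normedModType R) (f : V -> W)
    (u v : V) (df : W) :
  is_derive (0 : R) 1 (fun s : R => f (s *: v + u)) df -> is_derive u v f df.
Proof.
case=> /(derivable1P f u v) dd <-; split=> //.
have E : (fun h : R => h^-1 *: ((f \o shift u) (h *: v) - f u)) =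
    (fun h : R => h^-1 *: (((fun s : R => f (s *: v + u)) \o shift 0) (h *: 1)
       - f (0 *: v + u))).
  by apply/funext => h /=; rewrite [h *: 1]mulr1 addr0 scale0r add0r.
by rewrite /derive E.
Qed.

Lemma is_derive_fcomp (R : realType) (V : normedModType R) (f : V -> R)
    (g : R -> R) (u v : V) (df dg : R) :
  is_derive (f u) 1 g dg -> is_derive u v f df ->
  is_derive u v (fun z => g (f z)) (dg * df).
Proof.
move=> gd fd; apply: is_derive_line0.
have fd' : is_derive (0 : R) 1 (fun s : R => f (s *: v + u)) df.
  by apply: is_derive_line; rewrite scale0r add0r.
have gd' : is_derive (f (0 *: v + u)) 1 g dg by rewrite scale0r add0r.
exact: (is_derive1_comp gd' fd').
Qed.

Lemma enorm_gt0 (R : realType) n (v : 'rV[R]_n) : v != 0 -> 0 < enorm v.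
Proof.
rewrite /enorm sqrtr_gt0 lt0r sumr_ge0 ?andbT => [|j _]; last exact: sqr_ge0.
apply: contra => /eqP v0; apply/eqP/rowP => j; rewrite [RHS]mxE; apply/eqP.
rewrite -sqrf_eq0; apply/eqP; apply: (psumr_eq0P _ v0) => // l _.
exact: sqr_ge0.
Qed.

(** At a regular point the sum of squares under each root is positive, so root and inverse are
    differentiable there; 1/(2|x|) contributes -<x, dx>/(2|x|^3). *)
Lemma is_derive_potential (R : realType) (V : normedModType R) (k : nat)
    (p : 'I_k -> 'rV[R]_3) (m : R) (F : V -> 'rV[R]_3) (u v : V)
    (dF : 'rV[R]_3) :
  regular_pts p (F u) -> is_derive u v F dF ->
  is_derive u v (fun z => gh_potential p m (F z))
    (- \sum_i (2 * enorm (F u - p i) ^+ 3)^-1 *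
         \sum_j (F u - p i) 0 j * dF 0 j).
Proof.
have mE : (fun z => gh_potential p m (F z)) = (fun z => cst m z +
    \sum_i (2 * Num.sqrt (\sum_j (F z - p i) 0 j * (F z - p i) 0 j))^-1).
  by apply/funext => z; rewrite /gh_potential /enorm; congr (m + _).
move=> reg dFu; rewrite mE -[X in is_derive _ _ _ X]add0r -sumrN.
suff T i : is_derive u v
    (fun z => (2 * Num.sqrt (\sum_j (F z - p i) 0 j * (F z - p i) 0 j))^-1)
    (- ((2 * enorm (F u - p i) ^+ 3)^-1 * \sum_j (F u - p i) 0 j * dF 0 j)).
  exact: is_derive_fadd (is_derive_cst m u v) (is_derive_fsum T).
have nE : enorm (F u - p i) =
    Num.sqrt (\sum_j (F u - p i) 0 j * (F u - p i) 0 j).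
  by rewrite /enorm; congr Num.sqrt; apply: eq_bigr => j _; rewrite expr2.
have s0 : 0 < enorm (F u - p i) by rewrite enorm_gt0 // subr_eq0; exact: reg.
have q0 : 0 < \sum_j (F u - p i) 0 j * (F u - p i) 0 j.
  by rewrite -sqrtr_gt0 -nE.
have dj j : is_derive u v (fun z => (F z - p i) 0 j) (dF 0 j).
  have -> : (fun z => (F z - p i) 0 j) = (fun z => F z 0 j + cst (- p i 0 j) z).
    by apply/funext => z; rewrite !mxE.
  rewrite -[dF 0 j]addr0; apply: is_derive_fadd; exact: is_derive_coord.
have dq := is_derive_fsum (fun j => is_derive_fmul (dj j) (dj j)).
have ds := is_derive_fscale 2 (is_derive_fcomp (is_derive1_sqrt q0) dq).
have s2 : 2 * Num.sqrt (\sum_j (F u - p i) 0 j * (F u - p i) 0 j) != 0.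
  by rewrite -nE mulf_neq0 // gt_eqF.
have D := is_derive_finv (f := fun z =>
  2 * Num.sqrt (\sum_j (F z - p i) 0 j * (F z - p i) 0 j)) s2 ds.
apply: is_derive_eq D _.
rewrite -nE big_split /=; set A := \sum_j _; set e := enorm _ in s0 *.
by field; rewrite gt_eqF.
Qed.

(** * Christoffel symbols and mean curvature *)

Section MatrixDerivative.
Variables (R : realType) (n : nat) (g : 'rV[R]_n -> 'M[R]_n) (u : 'rV[R]_n).
Hypothesis dg : differentiable g u.

Lemma derive_bilinear (a b c : 'rV[R]_n) :
  is_derive u a (fun z => (b *m g z *m c^T) 0 0)
    (\sum_i \sum_j \sum_l a 0 i * b 0 j * c 0 l *
       partial i (fun z => g z j l) u).
Proof.
have P j l : is_derive u a (fun z => g z j l)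
    (\sum_i a 0 i * partial i (fun z => g z j l) u).
  have -> : \sum_i a 0 i * partial i (fun z => g z j l) u = ('D_a g u) j l.
    rewrite deriveE // [in RHS](row_sum_delta a) linear_sum summxE.
    apply: eq_bigr => i _; rewrite linearZ mxE /partial -deriveE //.
    by rewrite derive_mx ?mxE //; exact: diff_derivable.
  by apply: is_derive_coord; apply: derivableP; exact: diff_derivable.
have D := is_derive_fsum (fun j => is_derive_fsum (fun l =>
  is_derive_fscale (b 0 j * c 0 l) (P j l))).
have -> : (fun z => (b *m g z *m c^T) 0 0) =
    (fun z => \sum_j \sum_l b 0 j * c 0 l * g z j l).
  apply/funext => z; rewrite exchange_big mxE; apply: eq_bigr => l _.
  rewrite mxE mxE mulr_suml; apply: eq_bigr => j _; ring.
apply: is_derive_eq D _.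
under eq_bigr do under eq_bigr do rewrite mulr_sumr.
under eq_bigr do rewrite exchange_big /=.
rewrite exchange_big /=; apply: eq_bigr => i _.
by apply: eq_bigr => j _; apply: eq_bigr => l _; ring.
Qed.

End MatrixDerivative.

(* The Koszul formula, with [V] the [g]-dual of [alpha]. *)
Lemma christoffel_quad (R : realType) (n : nat) (g : 'rV[R]_n -> 'M[R]_n)
    (u alpha V w : 'rV[R]_n) :
  differentiable g u -> g u \in unitmx -> (g u)^T = g u -> V *m g u = alpha ->
  \sum_i \sum_j w 0 i * w 0 j * (christoffel g u i j *m alpha^T) 0 0 =
    'D_w (fun z => (w *m g z *m V^T) 0 0) u -
    2^-1 * 'D_V (fun z => (w *m g z *m w^T) 0 0) u.
Proof.
move=> dg gu gT Va.
rewrite (@derive_val _ _ _ _ _ _ _ (derive_bilinear dg w w V)).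
rewrite (@derive_val _ _ _ _ _ _ _ (derive_bilinear dg V w w)).
set P := fun i j l => partial i (fun z => g z j l) u.
(* Pairing with [alpha] absorbs the inverse metric of the Christoffel symbols into [V]. *)
have VE : V = alpha *m invmx (g u) by rewrite -Va mulmxK.
have C i j : (christoffel g u i j *m alpha^T) 0 0 =
    \sum_l 2^-1 * V 0 l * (P i j l + P j i l - P l i j).
  rewrite mxE.
  under eq_bigr do rewrite !mxE mulr_sumr mulr_suml.
  rewrite exchange_big; apply: eq_bigr => l _; rewrite VE mxE mulr_sumr mulr_suml.
  by apply: eq_bigr => k _; rewrite /P; ring.
under eq_bigr do under eq_bigr do rewrite C.
(* Renaming summation indices shows that the first two terms of the Christoffel symbol contribute
   equally, which cancels the factor 1/2 on them. *)
have S1 : \sum_i \sum_j \sum_l w 0 i * w 0 j * V 0 l * P j i l =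
          \sum_i \sum_j \sum_l w 0 i * w 0 j * V 0 l * P i j l.
  rewrite exchange_big; apply: eq_bigr => i _; apply: eq_bigr => j _.
  by apply: eq_bigr => l _; ring.
have S2 : \sum_i \sum_j \sum_l V 0 i * w 0 j * w 0 l * P i j l =
          \sum_i \sum_j \sum_l w 0 i * w 0 j * V 0 l * P l i j.
  rewrite exchange_big; apply: eq_bigr => i _; rewrite exchange_big.
  by apply: eq_bigr => j _; apply: eq_bigr => l _; ring.
rewrite S2.
transitivity (2^-1 * (\sum_i \sum_j \sum_l w 0 i * w 0 j * V 0 l * P i j l
   + \sum_i \sum_j \sum_l w 0 i * w 0 j * V 0 l * P j i l
   - \sum_i \sum_j \sum_l w 0 i * w 0 j * V 0 l * P l i j)); last first.
  by rewrite S1; field.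
rewrite -!big_split -sumrB mulr_sumr; apply: eq_bigr => i _.
rewrite -!big_split -sumrB mulr_sumr; apply: eq_bigr => j _.
rewrite -!big_split -sumrB !mulr_sumr; apply: eq_bigr => l _ /=; ring.
Qed.

(** The covector [alpha] kills the slice, so pairing with it makes the tangential correction in
    [normal_part] disappear. If [W] is the matrix of an orthonormal frame, the inverse of the
    induced metric is [W^T *m W], which turns the trace into a sum over the frame. *)
Lemma mean_curvature_orthonormal (R : realType) (n : nat)
    (g : 'rV[R]_n.+1 -> 'M[R]_n.+1) (u alpha : 'rV[R]_n.+1)
    (w : 'I_n -> 'rV[R]_n.+1) :
  (forall i, w i 0 ord_max = 0) ->
  (forall i j, (w i *m g u *m (w j)^T) 0 0 = (i == j)%:R) ->
  (forall a, alpha 0 (lift ord_max a) = 0) ->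
  (mean_curvature g u *m alpha^T) 0 0 =
    \sum_i \sum_j \sum_k
      w i 0 j * w i 0 k * (christoffel g u j k *m alpha^T) 0 0.
Proof.
move=> w0 orth a0.
pose W := \matrix_(i, a) w i 0 (lift ord_max a).
have WhW : W *m induced_metric g u *m W^T = 1%:M.
  apply/matrixP => i j; rewrite mxE [RHS]mxE -orth [RHS]mxE.
  rewrite [RHS](bigD1_ord ord_max) //= [(w j)^T _ _]mxE w0 mulr0 add0r.
  apply: eq_bigr => b _; rewrite !mxE; congr (_ * _).
  rewrite [RHS](bigD1_ord ord_max) //= w0 mul0r add0r.
  by apply: eq_bigr => a _; rewrite !mxE.
have hWW : induced_metric g u *m (W^T *m W) = 1%:M.
  by rewrite mulmxA; apply: mulmx1C; rewrite mulmxA.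
have [hu _] := mulmx1_unit hWW.
have hI : invmx (induced_metric g u) = W^T *m W.
  by rewrite -[RHS]mul1mx -(mulVmx hu) -mulmxA hWW mulmx1.
have tan a : (tangent_vec R a *m alpha^T) 0 0 = 0.
  by rewrite /tangent_vec -rowE !mxE a0.
have nrm v : (normal_part g u v *m alpha^T) 0 0 = (v *m alpha^T) 0 0.
  rewrite /normal_part mulmxBl mxE [X in _ + X]mxE mulmx_suml summxE big1 ?subr0 //.
  move=> a _; rewrite mulmx_suml summxE big1 // => b _.
  by rewrite -scalemxAl mxE tan mulr0.
rewrite /mean_curvature mulmx_suml summxE.
transitivity (\sum_a \sum_b \sum_i W i a * W i b *
  (christoffel g u (lift ord_max a) (lift ord_max b) *m alpha^T) 0 0).
  apply: eq_bigr => a _; rewrite mulmx_suml summxE; apply: eq_bigr => b _.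
  rewrite -scalemxAl mxE nrm hI mxE mulr_suml.
  by apply: eq_bigr => i _; rewrite mxE.
rewrite [RHS](eq_bigr (fun i => \sum_a \sum_b W i a * W i b *
  (christoffel g u (lift ord_max a) (lift ord_max b) *m alpha^T) 0 0)); last first.
  move=> i _; rewrite (bigD1_ord ord_max) //= [X in X + _]big1 ?add0r; last first.
    by move=> k _; rewrite w0 !mul0r.
  apply: eq_bigr => a _; rewrite (bigD1_ord ord_max) //= w0 mulr0 mul0r add0r.
  by apply: eq_bigr => b _; rewrite !mxE.
by rewrite [RHS]exchange_big; apply: eq_bigr => a _; rewrite exchange_big.
Qed.

(** * The Gibbons-Hawking metric in a chart *)

Lemma sum_ord3 (R : realType) (F : 'I_3 -> R) :
  \sum_i F i = F 0 + F 1 + F ord_max.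
Proof.
rewrite !big_ord_recl big_ord0 addr0 addrA; congr (_ + F _ + F _); exact: val_inj.
Qed.

Lemma ord3_ind (P : 'I_3 -> Prop) : P 0 -> P 1 -> P ord_max -> forall i, P i.
Proof.
move=> P0 P1 P2 [[|[|[|//]]] h].
- by have -> : Ordinal h = 0 by exact: val_inj.
- by have -> : Ordinal h = 1 by exact: val_inj.
- by have -> : Ordinal h = ord_max by exact: val_inj.
Qed.

Definition row3 (R : realType) (a b c : R) : 'rV[R]_3 :=
  \row_k (if k == 0 then a else if k == 1 then b else c).

Lemma row3E (R : realType) (a b c : R) :
  (row3 a b c 0 0 = a) * (row3 a b c 0 1 = b) * (row3 a b c 0 ord_max = c).
Proof. by rewrite /row3 !mxE. Qed.

Lemma mx_dotE (R : realType) n (a b : 'rV[R]_n) :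
  (a *m b^T) 0 0 = \sum_i a 0 i * b 0 i.
Proof. by rewrite mxE; apply: eq_bigr => i _; rewrite mxE. Qed.

Lemma trmx11 (R : realType) (A : 'M[R]_1) : A^T 0 0 = A 0 0.
Proof. by rewrite mxE. Qed.

Lemma mx_outerE (R : realType) n (e v w : 'rV[R]_n) :
  (v *m (e^T *m e) *m w^T) 0 0 = (v *m e^T) 0 0 * (w *m e^T) 0 0.
Proof.
rewrite mulmxA -mulmxA mxE big_ord1; congr (_ * _).
by rewrite -trmx11 trmx_mul trmxK.
Qed.

Lemma mx_gramE (R : realType) n l (A : 'M[R]_(n, l)) (v w : 'rV[R]_n) :
  (v *m (A *m A^T) *m w^T) 0 0 = \sum_k (v *m A) 0 k * (w *m A) 0 k.
Proof. by rewrite -mx_dotE trmx_mul !mulmxA. Qed.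

(* With [phi], [eW], [eV], [XW], [XV] standing for the potential, [eta w],
   [eta V], [dx w] and [dx V], the two differentiated functions are
   [g(w, V)] and [g(w, w)]. *)
Lemma gh_koszul (R : realType) (E : normedModType R)
    (phi eW eV : E -> R) (XW XV : 'I_3 -> E -> R) (u w V : E)
    (phiw phiV eWw eWV eVw : R) (XWw XVw : 'I_3 -> R) :
  is_derive u w phi phiw -> is_derive u V phi phiV ->
  is_derive u w eW eWw -> is_derive u V eW eWV -> is_derive u w eV eVw ->
  (forall k, is_derive u w (XW k) (XWw k)) ->
  (forall k, is_derive u V (XW k) (XVw k)) ->
  (forall k, is_derive u w (XV k) (XVw k)) ->
  phi u != 0 -> eV u = 0 ->
  'D_w (fun z => (phi z)^-1 * (eW z * eV z) + phi z * \sum_k XW k z * XV k z) u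
  - 2^-1 *
  'D_V (fun z => (phi z)^-1 * (eW z * eW z) + phi z * \sum_k XW k z * XW k z) u
  = (phi u)^-1 * eW u * (eVw - eWV) + phiw * (\sum_k XW k u * XV k u)
    + phi u * (\sum_k XWw k * XV k u)
    + 2^-1 * (phi u)^-2 * phiV * eW u ^+ 2
    - 2^-1 * phiV * \sum_k XW k u ^+ 2.
Proof.
move=> dpw dpV dWw dWV dVw dXWw dXWV dXVw p0 eV0.
have D1 := is_derive_fadd
  (is_derive_fmul (is_derive_finv p0 dpw) (is_derive_fmul dWw dVw))
  (is_derive_fmul dpw
     (is_derive_fsum (fun k => is_derive_fmul (dXWw k) (dXVw k)))).
have D2 := is_derive_fadd
  (is_derive_fmul (is_derive_finv p0 dpV) (is_derive_fmul dWV dWV))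
  (is_derive_fmul dpV
     (is_derive_fsum (fun k => is_derive_fmul (dXWV k) (dXWV k)))).
rewrite (@derive_val _ _ _ _ _ _ _ D1) (@derive_val _ _ _ _ _ _ _ D2) eV0.
by rewrite !sum_ord3; field.
Qed.

(** * Second order analysis at a point of a chart, with [x] the projection in coordinates *)

Section GHMetric.
Variables (R : realType) (x : 'rV[R]_4 -> 'rV[R]_3).
Variables (eta : 'rV[R]_4 -> 'rV[R]_4) (g : 'rV[R]_4 -> 'M[R]_4).
Variables (phi : 'rV[R]_4 -> R) (D : set 'rV[R]_4) (u : 'rV[R]_4).
Hypotheses (oD : open D) (Du : D u) (x_smooth : smooth_on D x).

Let J := jacobian x u.

Lemma is_derive_smooth z v k : D z ->
  is_derive z v (fun z => x z 0 k) (('D_v x z) 0 k).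
Proof.
move=> Dz; apply: is_derive_coord; apply: derivableP; apply: diff_derivable.
exact: (x_smooth 1).1.
Qed.

Lemma is_derive_smooth2 z v w k : D z ->
  is_derive z w (fun z => ('D_v x z) 0 k) (('D_w ('D_v x) z) 0 k).
Proof.
move=> Dz; apply: is_derive_coord; apply: derivableP; apply: diff_derivable.
exact: ((x_smooth 2).2 v).1.
Qed.

(** In the Koszul formula this exchanges the derivative of dx(w) along [V] for that of dx(V) along
    [w]. *)
Lemma smooth_derive_comm v w k :
  ('D_w ('D_v x) u) 0 k = ('D_v ('D_w x) u) 0 k.
Proof.
have nD : \forall z \near u, D z by apply: open_nbhs_nbhs.
have cont a b : {for u, continuous (fun z => ('D_a ('D_b x) z) 0 k)}.
  apply: (@continuous_comp _ _ _ ('D_a ('D_b x)) (fun M : 'rV[R]_3 => M 0 k)).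
    exact: ((x_smooth 2).2 b).2 a u Du.
  exact: coord_continuous.
apply: (is_derive_comm (f := fun z => x z 0 k)
  (fv := fun z => ('D_v x z) 0 k) (fw := fun z => ('D_w x z) 0 k)
  (fvw := fun z => ('D_w ('D_v x) z) 0 k)
  (fwv := fun z => ('D_v ('D_w x) z) 0 k)) (cont _ _) (cont _ _).
- by apply: filterS nD => z Dz; split; apply: is_derive_smooth.
- by apply: filterS nD => z Dz; split; apply: is_derive_smooth2.
Qed.

Lemma jacobianE v : v *m J = 'D_v x u.
Proof. by rewrite deriveEjacobian //; exact: (x_smooth 1).1. Qed.

Hypotheses (eta_diff : differentiable eta u) (g_diff : differentiable g u).

(** This is d eta(v, w) = v(eta(w)) - w(eta(v)); the fields [v] and [w] are constant, so no bracket
    term appears. *)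
Lemma ext_d_bilinear (v w : 'rV[R]_4) : (v *m ext_d eta u *m w^T) 0 0 =
  (w *m ('D_v eta u)^T) 0 0 - (v *m ('D_w eta u)^T) 0 0.
Proof.
pose K := jacobian eta u.
have EK : ext_d eta u = K - K^T.
  apply/matrixP => i j; rewrite !mxE.
  have P a b : partial a (fun z => eta z 0 b) u = K a b.
    have dd := @diff_derivable _ _ _ _ _ (delta_mx 0 a) eta_diff.
    have := deriveEjacobian (delta_mx 0 a) eta_diff.
    rewrite -rowE (derive_mx dd) => /rowP/(_ b); rewrite !mxE => <-.
    by [].
  by rewrite !P !mxE.
rewrite EK !deriveEjacobian // !trmx_mul mulmxBr mulmxBl mxE [X in _ + X]mxE.
congr (_ - _); last by rewrite mulmxA.
by rewrite -[LHS]trmx11 !trmx_mul !trmxK.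
Qed.

Lemma is_derive_oneform (v w : 'rV[R]_4) :
  is_derive u w (fun z => (v *m (eta z)^T) 0 0) ((v *m ('D_w eta u)^T) 0 0).
Proof.
have de : is_derive u w eta ('D_w eta u).
  by apply: derivableP; exact: diff_derivable.
have := is_derive_fsum (fun j : 'I_4 =>
  is_derive_fscale (v 0 j) (@is_derive_coord _ _ 1 4 _ _ _ _ 0 j de)).
rewrite mx_dotE; have -> // : (fun z => (v *m (eta z)^T) 0 0) =
  (fun z => \sum_j v 0 j * eta z 0 j).
by apply/funext => z; rewrite mx_dotE.
Qed.

Hypothesis gE : \forall z \near u, g z = (phi z)^-1 *: ((eta z)^T *m eta z)
  + phi z *: (jacobian x z *m (jacobian x z)^T).
Hypothesis gT : (g u)^T = g u.
Hypothesis gpos : forall v : 'rV[R]_4, v != 0 -> 0 < (v *m g u *m v^T) 0 0.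
Hypothesis phi_pos : 0 < phi u.
Variable dphi : 'rV[R]_3 -> R.
Hypothesis phi_derive : forall v, is_derive u v phi (dphi (v *m J)).
Variable H : 'M[R]_3.
Hypothesis curv : ext_d eta u = J *m H *m J^T.

(** The formula is needed on a neighbourhood because both sides are differentiated afterwards. *)
Lemma gh_formE (v w : 'rV[R]_4) : \forall z \near u, (v *m g z *m w^T) 0 0 =
  (phi z)^-1 * ((v *m (eta z)^T) 0 0 * (w *m (eta z)^T) 0 0) +
  phi z * \sum_k ('D_v x z) 0 k * ('D_w x z) 0 k.
Proof.
have nD : \forall z \near u, D z by apply: open_nbhs_nbhs.
apply: filterS2 gE nD => z -> Dz.
have dx : differentiable x z by exact: (x_smooth 1).1.
rewrite mulmxDr mulmxDl -!scalemxAr -!scalemxAl [LHS]mxE [X in X + _]mxE.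
rewrite [X in _ + X]mxE mx_outerE mx_gramE.
by congr (_ + _ * _); apply: eq_bigr => k _; rewrite !deriveEjacobian.
Qed.

(** A vector killed by both eta and dx would have zero length, so (eta, dx) is injective; it is a
    map between spaces of dimension 4 = 1 + 3, hence bijective, and [L] is its inverse. *)
Lemma gh_lift : exists L : R -> 'rV[R]_3 -> 'rV[R]_4,
  forall s t, (L s t *m (eta u)^T) 0 0 = s /\ L s t *m J = t.
Proof.
pose M := row_mx (eta u)^T J.
have Mfree : row_free M.
  apply: inj_row_free => v vM.
  have /eq_row_mx[v1 v2] : row_mx (v *m (eta u)^T) (v *m J) = row_mx 0 0.
    by rewrite -mul_mx_row vM row_mx0.
  apply/eqP; apply: contraT => v0; have := gpos v0; rewrite (nbhs_singleton gE).
  rewrite mulmxDr -!scalemxAr !mulmxA v1 v2 !mul0mx !scaler0 addr0 mul0mx mxE.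
  by rewrite ltxx.
have Mfull : row_full M by exact: Mfree.
exists (fun s t => row_mx s%:M t *m pinvmx M) => s t.
have := mulmxKpV (submx_full (row_mx s%:M t : 'rV_(1 + 3)) Mfull).
rewrite {2}/M mul_mx_row => /eq_row_mx[-> ->].
by rewrite mxE eqxx mulr1n.
Qed.

Lemma gh_unitmx : g u \in unitmx.
Proof.
rewrite -row_free_unit; apply: inj_row_free => v vg.
by apply/eqP; apply: contraT => /gpos; rewrite vg mul0mx mxE ltxx.
Qed.

(* [w] is vertical or horizontal, so that [eta(w) * deta(w, V)], where the
   curvature would enter, vanishes. *)
Lemma gh_christoffel_tangent (df : 'rV[R]_3) (w V : 'rV[R]_4) :
  (w *m (eta u)^T) 0 0 = 0 \/ w *m J = 0 ->
  (w *m J *m df^T) 0 0 = 0 ->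
  (V *m (eta u)^T) 0 0 = 0 -> V *m J = (phi u)^-1 *: df ->
  \sum_i \sum_j w 0 i * w 0 j * (christoffel g u i j *m (df *m J^T)^T) 0 0 =
    (('D_w ('D_w x) u) *m df^T) 0 0
    + 2^-1 * (phi u)^-2 * dphi (V *m J) * (w *m (eta u)^T) 0 0 ^+ 2
    - 2^-1 * dphi (V *m J) * \sum_k (w *m J) 0 k ^+ 2.
Proof.
move=> w_or w_tan V_hor VJ.
have phi0 : phi u != 0 by rewrite gt_eqF.
(* Only the horizontal part of the metric sees [V], and its factor phi cancels the one in [V]: thus
   [V] is the metric dual of the pullback of [df]. *)
have Vg : V *m g u = df *m J^T.
  rewrite (nbhs_singleton gE) mulmxDr -!scalemxAr !mulmxA.
  have -> : V *m (eta u)^T = 0.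
    by apply/matrixP => i j; rewrite !ord1 V_hor mxE.
  by rewrite mul0mx scaler0 add0r VJ -!scalemxAl scalerA divff // scale1r.
rewrite (christoffel_quad w g_diff gh_unitmx gT Vg).
rewrite (near_eq_derive _ (gh_formE w V)) (near_eq_derive _ (gh_formE w w)).
rewrite (gh_koszul (phi_derive w) (phi_derive V) (is_derive_oneform w w)
  (is_derive_oneform w V) (is_derive_oneform V w)
  (fun k => is_derive_smooth2 w w k Du) (fun k => is_derive_smooth2 w V k Du)
  _ phi0 V_hor); last first.
  by move=> k; rewrite smooth_derive_comm; exact: is_derive_smooth2.
rewrite -ext_d_bilinear curv.
have -> : (phi u)^-1 * (w *m (eta u)^T) 0 0 *
    (w *m (J *m H *m J^T) *m V^T) 0 0 = 0.
  case: w_or => [->|wJ]; first by rewrite mulr0 mul0r.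
  by rewrite !mulmxA wJ !mul0mx [X in _ * X]mxE mulr0.
rewrite -!jacobianE.
(* The term with the derivative of phi along [w] drops out because [w] is tangent to the level set
   of [df]. *)
have -> : \sum_k (w *m J) 0 k * (V *m J) 0 k = 0.
  rewrite -mx_dotE VJ linearZ /= -scalemxAr mxE w_tan; exact: mulr0.
rewrite mulr0 addr0 add0r; congr (_ + _ - _).
rewrite VJ mx_dotE mulr_sumr; apply: eq_bigr => k _; rewrite mxE.
by field.
Qed.

(** The Euclidean gradient of the squared distance to the x_3-axis; squaring keeps the function
    smooth on the axis. *)
Definition axis_gradient : 'rV[R]_3 := row3 (2 * x u 0 0) (2 * x u 0 1) 0.

(* The second derivative test for the squared distance to the axis on the
   slice, traced over the orthonormal frame of the cylinder made of the
   vertical, the angular and the axial direction. *)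
Lemma gh_max_inequality :
  mean_curvature g u = 0 -> u 0 ord_max = 0 ->
  0 < x u 0 0 ^+ 2 + x u 0 1 ^+ 2 ->
  (\forall z \near u, (z : 'rV[R]_4) 0 ord_max = 0 ->
     x z 0 0 ^+ 2 + x z 0 1 ^+ 2 <= x u 0 0 ^+ 2 + x u 0 1 ^+ 2) ->
  2 + 2^-1 * dphi ((phi u)^-1 *: axis_gradient) <= 0.
Proof.
set a := x u 0 0; set b := x u 0 1; set df := axis_gradient.
move=> H0 u0 r0 umax.
have phi0 : phi u != 0 by rewrite gt_eqF.
have dfE (t : 'rV[R]_3) : (t *m df^T) 0 0 = 2 * (t 0 0 * a + t 0 1 * b).
  by rewrite mx_dotE sum_ord3 /df /axis_gradient !row3E -/a -/b; ring.
pose F (z : 'rV[R]_4) := x z 0 0 * x z 0 0 + x z 0 1 * x z 0 1.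
pose F1 (w z : 'rV[R]_4) :=
  (x z 0 0 * ('D_w x z) 0 0 + x z 0 0 * ('D_w x z) 0 0) +
  (x z 0 1 * ('D_w x z) 0 1 + x z 0 1 * ('D_w x z) 0 1).
have Fd (w : 'rV[R]_4) : \forall z \near u, is_derive z w F (F1 w z).
  have nD : \forall z \near u, D z by apply: open_nbhs_nbhs.
  apply: filterS nD => z Dz.
  by apply: is_derive_fadd; apply: is_derive_fmul; apply: is_derive_smooth.
have Fmax (w : 'rV[R]_4) : w 0 ord_max = 0 ->
    \forall t \near (0 : R), F (t *: w + u) <= F u.
  move=> w0; apply: filterS (near_line w umax) => t; rewrite /F -!expr2; apply.
  by rewrite !mxE w0 u0 mulr0 addr0.
have tangent (w : 'rV[R]_4) : w 0 ord_max = 0 -> (w *m J *m df^T) 0 0 = 0.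
  move=> w0; rewrite -(line_max_derive (Fd w) (Fmax w w0)) /F1 dfE jacobianE.
  by rewrite -/a -/b; ring.
(* The second derivative of [F] along [w] is 2 (a A + b B + A'^2 + B'^2), where primes denote
   components of dx(w); it is nonpositive at the maximum. *)
have concave (w : 'rV[R]_4) : w 0 ord_max = 0 ->
    (('D_w ('D_w x) u) *m df^T) 0 0 <=
      - 2 * ((w *m J) 0 0 ^+ 2 + (w *m J) 0 1 ^+ 2).
  move=> w0.
  have dd k := is_derive_fmul (is_derive_smooth w k Du)
    (is_derive_smooth2 w w k Du).
  have F1d := is_derive_fadd (is_derive_fadd (dd 0) (dd 0))
    (is_derive_fadd (dd 1) (dd 1)).
  have arith (A B A' B' : R) :
      (a * A + A' * A' + (a * A + A' * A')) +
      (b * B + B' * B' + (b * B + B' * B')) <= 0 ->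
    2 * (A * a + B * b) <= - 2 * (A' ^+ 2 + B' ^+ 2) by move=> ?; lra.
  rewrite dfE jacobianE.
  exact: arith (line_max_derive2 (Fd w) F1d (Fmax w w0)).
have [L LE] := gh_lift.
have LJ s t : L s t *m J = t by exact: (LE s t).2.
have Le s t : (L s t *m (eta u)^T) 0 0 = s by exact: (LE s t).1.
pose alpha := df *m J^T.
have alphaE (w : 'rV[R]_4) : (w *m alpha^T) 0 0 = (w *m J *m df^T) 0 0.
  by rewrite /alpha trmx_mul trmxK mulmxA.
have alpha0 c : alpha 0 (lift ord_max c) = 0.
  have e0 : (delta_mx 0 (lift ord_max c) : 'rV[R]_4) 0 ord_max = 0.
    by rewrite mxE /= (negbTE (neq_lift _ _)).
  have := tangent _ e0; rewrite -alphaE -rowE => <-; by rewrite !mxE.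
have alpha_last (w : 'rV[R]_4) :
    (w *m alpha^T) 0 0 = w 0 ord_max * alpha 0 ord_max.
  rewrite mx_dotE (bigD1_ord ord_max) //= big1 ?addr0 // => c _.
  by rewrite alpha0 mulr0.
pose V := L 0 ((phi u)^-1 *: df).
(* The covector [alpha] vanishes on the slice by the first order condition, and its value on [V] is
   4 (a^2 + b^2) / phi > 0. So its kernel is exactly the tangent space of the slice, which therefore
   contains the cylinder frame. *)
have last_neq0 : alpha 0 ord_max != 0.
  apply: contraTN r0 => /eqP l0; rewrite -leNgt.
  have := alpha_last V; rewrite l0 mulr0 alphaE LJ dfE !mxE /= -/a -/b => E.
  have : (phi u)^-1 * (a ^+ 2 + b ^+ 2) = 0 by lra.
  by move/eqP; rewrite mulf_eq0 invr_eq0 (negbTE phi0) /= => /eqP ->.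
have in_slice (w : 'rV[R]_4) : (w *m J *m df^T) 0 0 = 0 -> w 0 ord_max = 0.
  rewrite -alphaE alpha_last => /eqP; rewrite mulf_eq0 (negbTE last_neq0) orbF.
  by move/eqP.
pose h := Num.sqrt (phi u).
have h2 : h ^+ 2 = phi u by rewrite sqr_sqrtr ?ltW.
have h0 : h != 0 by rewrite gt_eqF // sqrtr_gt0.
pose r := Num.sqrt (a ^+ 2 + b ^+ 2).
have r2 : r ^+ 2 = a ^+ 2 + b ^+ 2 by rewrite sqr_sqrtr ?ltW.
have rn0 : r != 0 by rewrite gt_eqF // sqrtr_gt0.
(* The vertical vector has squared length phi^-1 s^2 and a horizontal one phi |t|^2; this fixes the
   normalisations h, 1/(h r) and 1/h. *)
pose s (i : 'I_3) := if i == 0 then h else 0.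
pose t (i : 'I_3) := if i == 0 then 0 else
  if i == 1 then row3 (- b / (h * r)) (a / (h * r)) 0 else row3 0 0 h^-1.
pose w i := L (s i) (t i).
have t_df i : (w i *m J *m df^T) 0 0 = 0.
  rewrite LJ dfE; elim/ord3_ind: i; rewrite /t /= ?row3E ?mxE; first by ring.
    by field; rewrite h0 rn0.
  by ring.
have w0 i : w i 0 ord_max = 0 by exact: in_slice.
have orth i j : (w i *m g u *m (w j)^T) 0 0 = (i == j)%:R.
  rewrite (nbhs_singleton (gh_formE _ _)) !Le -!jacobianE !LJ sum_ord3 -h2.
  elim/ord3_ind: i; elim/ord3_ind: j; rewrite /s /t /= ?row3E ?mxE;
    try (by field; rewrite ?h0 ?rn0).
  transitivity ((a ^+ 2 + b ^+ 2) / r ^+ 2); first by field; rewrite h0 rn0.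
  by rewrite -r2 divff // expf_neq0.
have cond i : (w i *m (eta u)^T) 0 0 = 0 \/ w i *m J = 0.
  by rewrite Le LJ; elim/ord3_ind: i; [right|left|left].
have := mean_curvature_orthonormal w0 orth alpha0.
rewrite H0 mul0mx mxE.
rewrite (eq_bigr _ (fun i _ => gh_christoffel_tangent (cond i) (t_df i) (Le _ _) (LJ _ _))).
rewrite LJ !sum_ord3.
have S0 : s 0 ^+ 2 = phi u by [].
have S1 : s 1 ^+ 2 = 0 by rewrite /s /= expr0n.
have S2 : s ord_max ^+ 2 = 0 by rewrite /s /= expr0n.
have T0 k : t 0 0 k = 0 by rewrite /t /= mxE.
have T1 : t 1 0 0 ^+ 2 + t 1 0 1 ^+ 2 = (phi u)^-1.
  transitivity ((a ^+ 2 + b ^+ 2) / (h ^+ 2 * r ^+ 2)).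
    by rewrite /t /= !row3E; field; rewrite h0 rn0.
  by rewrite -r2 h2; field; rewrite phi0 rn0.
have T1' : t 1 0 ord_max = 0 by rewrite /t /= row3E.
have T2 : (t ord_max 0 0 = 0) * (t ord_max 0 1 = 0) by rewrite /t /= !row3E.
have T2' : t ord_max 0 ord_max ^+ 2 = (phi u)^-1.
  by rewrite /t /= row3E -h2; field.
(* The vertical direction contributes +d/(2 phi) and each of the two horizontal ones -d/(2 phi),
   leaving one negative copy; the Hessian terms add up to at most -2/phi. *)
have arith (A0 A1 A2 d : R) :
    A0 <= - 2 * (0 ^+ 2 + 0 ^+ 2) -> A1 <= - 2 * (phi u)^-1 ->
    A2 <= - 2 * (0 ^+ 2 + 0 ^+ 2) ->
    0 = A0 + 2^-1 * (phi u)^-2 * d * phi u - 2^-1 * d * (0 ^+ 2 + 0 ^+ 2 + 0 ^+ 2)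
      + (A1 + 2^-1 * (phi u)^-2 * d * 0 - 2^-1 * d * ((phi u)^-1 + 0 ^+ 2))
      + (A2 + 2^-1 * (phi u)^-2 * d * 0
         - 2^-1 * d * (0 ^+ 2 + 0 ^+ 2 + (phi u)^-1)) ->
    2 + 2^-1 * d <= 0.
  have -> : 2^-1 * (phi u)^-2 * d * phi u = 2^-1 * d * (phi u)^-1 by field.
  have : 0 < (phi u)^-1 by rewrite invr_gt0.
  move: (phi u)^-1 => q q0 h0' h1 h2' E.
  by rewrite -(pmulr_rle0 _ q0); lra.
have := concave _ (w0 ord_max); have := concave _ (w0 1); have := concave _ (w0 0).
rewrite !Le !LJ S0 S1 ?S2 !T0 T1 T1' !T2 T2'.
exact: arith.
Qed.

End GHMetric.

(** * Compact minimal hypersurfaces *)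

(** With x = (a, b) and q = (c, d), the difference of the two sides is |x|^2 - 3 <x, q> + 2 |q|^2.
    By Cauchy-Schwarz it is at least (|x| - |q|) (|x| - 2 |q|) > 0. *)
Lemma cylinder_estimate_outer (R : realType) (a b c d : R) :
  2 * Num.sqrt (c ^+ 2 + d ^+ 2) < Num.sqrt (a ^+ 2 + b ^+ 2) ->
  (a - c) * a + (b - d) * b < 2 * ((a - c) ^+ 2 + (b - d) ^+ 2).
Proof.
set r := Num.sqrt _; set s := Num.sqrt _ => rs.
have r0 : 0 <= r by exact: sqrtr_ge0.
have rE : r ^+ 2 = c ^+ 2 + d ^+ 2 by rewrite sqr_sqrtr // addr_ge0 // sqr_ge0.
have sE : s ^+ 2 = a ^+ 2 + b ^+ 2 by rewrite sqr_sqrtr // addr_ge0 // sqr_ge0.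
have cs : a * c + b * d <= s * r.
  have sr0 : 0 <= s * r by rewrite mulr_ge0 // sqrtr_ge0.
  apply: le_trans (ler_norm _) _; rewrite -(@ler_pXn2r _ 2) ?nnegrE //.
  rewrite real_normK ?num_real // exprMn rE sE.
  (* Lagrange's identity: this square is the defect in Cauchy-Schwarz. *)
  by have := sqr_ge0 (a * d - b * c); nra.
have : 0 < (s - r) * (s - 2 * r) by apply: mulr_gt0; lra.
by nra.
Qed.

(** With x = (a, b) and q = (c, d), twice the difference of the two sides is |x - q|^2 + |q|^2 -
    |x|^2, nonnegative if |x| < |q|. For q = 0 the two sides coincide. *)
Lemma cylinder_estimate_inner (R : realType) (a b c d : R) :
  (0 < Num.sqrt (c ^+ 2 + d ^+ 2) ->
     Num.sqrt (a ^+ 2 + b ^+ 2) < Num.sqrt (c ^+ 2 + d ^+ 2)) ->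
  (a - c) * a + (b - d) * b <= (a - c) ^+ 2 + (b - d) ^+ 2.
Proof.
have q0 : 0 <= c ^+ 2 + d ^+ 2 by rewrite addr_ge0 // sqr_ge0.
rewrite sqrtr_gt0 lt0r q0 andbT; have [q00 _|_ /(_ isT)] := eqVneq.
  have c0 : c ^+ 2 = 0 by have := sqr_ge0 c; have := sqr_ge0 d; lra.
  have d0 : d ^+ 2 = 0 by have := sqr_ge0 c; have := sqr_ge0 d; lra.
  move/eqP: c0; move/eqP: d0; rewrite !sqrf_eq0 => /eqP -> /eqP ->.
  by rewrite !subr0 -!expr2.
move=> lt; have {lt} : a ^+ 2 + b ^+ 2 < c ^+ 2 + d ^+ 2.
  by rewrite ltNge; apply: contraTN lt => /ler_wsqrtr; rewrite -leNgt.
by have := sqr_ge0 (a - c); have := sqr_ge0 (b - d); nra.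
Qed.

(** * From charts to hypersurfaces of the whole space *)

Section GHSpace.
Variables (R : realType) (k : nat) (p : 'I_k -> 'rV[R]_3) (m : R).
Variable X : gh_space p m.

Notation proj := (gh_proj (g := X)).
Notation axis2 x := ((x : 'rV[R]_3) 0 0 ^+ 2 + (x : 'rV[R]_3) 0 1 ^+ 2).

Section Chart.
Variables (c : chart R X 4) (y : X).
Hypotheses (ac : atlas c) (cy : cdom c y).

Let x (z : 'rV[R]_4) := proj (cinv c z).
Let u := cmap c y.

Lemma chart_ccod : ccod c u.
Proof. by exists y. Qed.

Lemma chart_proj : x u = proj y.
Proof. by rewrite /x /u cmapK. Qed.

Lemma chart_proj_smooth : smooth_on (ccod c) x.
Proof. by have := @gh_proj_smooth _ _ _ _ X c ac; rewrite setIT. Qed.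

Lemma gh_proj_continuous : {for y, continuous proj}.
Proof.
have cx : {for u, continuous x} by exact: (chart_proj_smooth 0) chart_ccod.
have nE : {near y, x \o cmap c =1 proj}.
  have : nbhs y (cdom c) by apply: open_nbhs_nbhs; split=> //; exact: open_cdom.
  by apply: filterS => z cz; rewrite /x /= cmapK.
have : (x \o cmap c) z @[z --> y] --> x u.
  exact: continuous_cvg cx (cmap_cont cy).
by rewrite chart_proj; apply: cvg_trans; exact: near_eq_cvg nE.
Qed.

Lemma proj_avoid i : proj y != p i -> \forall z \near u, x z != p i.
Proof.
move=> yi; have cx : {for u, continuous x}.
  exact: (chart_proj_smooth 0) chart_ccod.
have e0 : 0 < `|x u - p i| by rewrite chart_proj normr_gt0 subr_eq0.
move/cvgrPdist_lt : cx => /(_ _ e0); apply: filterS => z.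
by apply: contraTneq => ->; rewrite ltxx.
Qed.

Hypothesis reg : regular_pts p (proj y).

(** There are finitely many singular points, so regularity is an open condition and the metric
    formula may be differentiated. *)
Lemma gh_metric_near : \forall z \near u, gh_metric X c z =
  (gh_potential p m (x z))^-1 *: ((gh_eta c z)^T *m gh_eta c z) +
  gh_potential p m (x z) *: (jacobian x z *m (jacobian x z)^T).
Proof.
have nD : nbhs u (ccod c).
  by apply: open_nbhs_nbhs; split; [exact: open_ccod | exact: chart_ccod].
have nreg : \forall z \near u, regular_pts p (x z).
  apply: (@filter_forall _ _ (fun i z => x z != p i) (nbhs u)) => i.
  exact: proj_avoid.
apply: filterS2 nD nreg => _ [y' cy' <-].
by rewrite {1}/x cmapK // => ry'; rewrite (gh_metricE ac cy' ry') /x cmapK.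
Qed.

Lemma gh_metric_pos (v : 'rV[R]_4) : v != 0 ->
  0 < (v *m gh_metric X c u *m v^T) 0 0.
Proof. exact: gmx_pos ac chart_ccod v. Qed.

End Chart.

(** As [m] may be 0, strict positivity comes from one summand, which exists because [0 < k]. *)
Lemma gh_potential_pos (a : 'rV[R]_3) : regular_pts p a ->
  0 < gh_potential p m a.
Proof.
move=> reg; apply: ltr_wpDl; first exact: gh_mass X.
rewrite (bigD1 (Ordinal (gh_npts X))) //=; apply: ltr_wpDr.
  by apply: sumr_ge0 => i _; rewrite invr_ge0 mulr_ge0 // sqrtr_ge0.
by rewrite invr_gt0 mulr_gt0 // enorm_gt0 // subr_eq0.
Qed.

(** Multiplied by phi, [gh_max_inequality] bounds 2 phi = 2 m + sum_i 1/|d_i| from above by sum_i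
    <d_i, x>_h / (2 |d_i|^3), where <,>_h is the product of the first two coordinates. The assumed
    inequalities give the opposite strict estimate term by term. *)
Lemma minimal_max_not_mean_convex (S : set X) (y : X) :
  minimal_hypersurface (gh_metric X) S -> S y -> regular_pts p (proj y) ->
  (forall y', S y' -> axis2 (proj y') <= axis2 (proj y)) ->
  0 < axis2 (proj y) ->
  ~ (forall i, let d := proj y - p i in
       d 0 0 * proj y 0 0 + d 0 1 * proj y 0 1 < 2 * enorm d ^+ 2).
Proof.
move=> [hS minS] Sy reg ymax y0 convex.
have [c [ac slice] cy] := hS y Sy.
set a := proj y in reg ymax y0 convex *.
pose x (z : 'rV[R]_4) := proj (cinv c z); pose u := cmap c y.
have xu : x u = a by exact: chart_proj.
have xs : smooth_on (ccod c) x by exact: chart_proj_smooth.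
have oD : open (ccod c) by exact: open_ccod.
have Du : ccod c u by exact: chart_ccod.
have eta_diff : differentiable (gh_eta c) u.
  apply: ((oneform_smooth (gh_eta_oneform X) ac) 1).1.
  by exists y.
have g_diff : differentiable (gh_metric X c) u.
  by apply: ((gmx_smooth (gh_metric X) ac) 1).1.
have gT := gmx_sym (gh_metric X) ac Du.
pose phi z := gh_potential p m (x z).
have phi_pos : 0 < phi u by rewrite /phi xu; exact: gh_potential_pos.
pose dphi (v : 'rV[R]_3) := - \sum_i (2 * enorm (a - p i) ^+ 3)^-1 *
  \sum_j (a - p i) 0 j * v 0 j.
have phi_derive v : is_derive u v phi (dphi (v *m jacobian x u)).
  rewrite (jacobianE Du xs) /dphi -xu; apply: is_derive_potential.
    by rewrite xu.
  by apply: derivableP; apply: diff_derivable; exact: (xs 1).1.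
have u0 : u 0 ord_max = 0 by exact/(slice y cy).1.
have umax : \forall z \near u, (z : 'rV[R]_4) 0 ord_max = 0 ->
    axis2 (x z) <= axis2 (x u).
  have nD : nbhs u (ccod c) by exact: open_nbhs_nbhs.
  apply: filterS nD => _ [y' cy' <-] /(slice y' cy').2 Sy'.
  by rewrite xu /x cmapK //; exact: ymax.
have r0 : 0 < axis2 (x u) by rewrite xu.
have := gh_max_inequality oD Du xs eta_diff g_diff (gh_metric_near ac cy reg)
  gT (gh_metric_pos ac cy) phi_pos phi_derive (gh_curvature ac cy reg)
  (minS c y (conj ac slice) Sy cy) u0 r0 umax.
apply/negP; rewrite -ltNge.
have -> : dphi ((phi u)^-1 *: axis_gradient x u) = - ((phi u)^-1 *
    \sum_i (enorm (a - p i) ^+ 3)^-1 *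
      ((a - p i) 0 0 * a 0 0 + (a - p i) 0 1 * a 0 1)).
  rewrite /dphi mulr_sumr; congr (- _); apply: eq_bigr => i _.
  have e0 : 0 < enorm (a - p i) by rewrite enorm_gt0 // subr_eq0.
  have scale_coord (q : R) (v : 'rV[R]_3) j : (q *: v) 0 j = q * v 0 j.
    by rewrite mxE.
  rewrite sum_ord3 /axis_gradient xu !scale_coord !row3E mulr0.
  by field; rewrite !gt_eqF.
rewrite -(pmulr_rgt0 _ phi_pos).
have -> : phi u * (2 + 2^-1 * - ((phi u)^-1 * \sum_i (enorm (a - p i) ^+ 3)^-1 *
      ((a - p i) 0 0 * a 0 0 + (a - p i) 0 1 * a 0 1))) =
  2 * phi u - 2^-1 * \sum_i (enorm (a - p i) ^+ 3)^-1 *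
      ((a - p i) 0 0 * a 0 0 + (a - p i) 0 1 * a 0 1).
  by field; rewrite gt_eqF.
rewrite subr_gt0 /phi xu /gh_potential mulrDr.
apply: ltr_wpDl; first by rewrite mulr_ge0 //; exact: gh_mass X.
(* A sum of strict inequalities is strict only if some index exists. *)
rewrite !mulr_sumr; apply: ltr_sum.
  apply/hasP; exists (Ordinal (gh_npts X)); last by [].
  exact: mem_index_enum.
move=> i _; have e0 : 0 < enorm (a - p i) by rewrite enorm_gt0 // subr_eq0.
 have := convex i.
rewrite /=; move: (enorm (a - p i)) e0 => e e0.
move: (_ + _) => s se.
have -> : 2 * (2 * e)^-1 = 2^-1 * (e ^+ 3)^-1 * (2 * e ^+ 2).
  by field; rewrite gt_eqF.
have q0 : 0 < 2^-1 * (e ^+ 3)^-1 by rewrite mulr_gt0 // invr_gt0 exprn_gt0.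
by rewrite [ltLHS]mulrA ltr_pM2l.
Qed.

(** A coordinate line inside the slice meets the one-point fibre over each [p i] at most once, so
    all small nonzero parameters avoid the finitely many singular fibres. *)
Lemma hypersurface_regular_pt (S : set X) : hypersurface S -> S !=set0 ->
  exists2 y, S y & regular_pts p (proj y).
Proof.
move=> hS [y Sy]; have [c [ac slice] cy] := hS y Sy.
pose u := cmap c y; pose v : 'rV[R]_4 := delta_mx 0 (lift ord_max ord0).
have v0 : v 0 ord_max = 0 by rewrite mxE.
have u0 : u 0 ord_max = 0 by exact/(slice y cy).1.
have vn0 : v != 0.
  apply/eqP => /rowP/(_ (lift ord_max ord0)); rewrite !mxE !eqxx /=.
  by move/eqP; rewrite oner_eq0.
have nD : \forall t \near (0 : R), ccod c (t *: v + u).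
  apply: near_line; apply: open_nbhs_nbhs; split; first exact: open_ccod.
  by exists y.
have avoid i : \forall t \near (0 : R)^',
    ccod c (t *: v + u) -> proj (cinv c (t *: v + u)) != p i.
  have [[s [sD si]]|no] := pselect (exists s : R, ccod c (s *: v + u) /\
      proj (cinv c (s *: v + u)) = p i); last first.
    by apply: nearW => t tD; apply/eqP => ti; apply: no; exists t.
  have ts : \forall t \near (0 : R)^', t != s.
    have [->|s0] := eqVneq s 0; first exact: nbhs_dnbhs_neq.
    apply: nbhs_dnbhs; move: s0; rewrite -normr_gt0 => s0.
    have := @nbhs0_lt _ R _ s0; apply: filterS => t.
    by apply: contraTneq => ->; rewrite ltxx.
  apply: filterS ts => t ts tD; apply: contra ts => /eqP ti.
  have [q [_ uq]] := gh_added X i.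
  have E : cinv c (t *: v + u) = cinv c (s *: v + u).
    by rewrite -(uq _ ti) -(uq _ si).
  move: sD tD E => [ys cs Es] [yt ct Et]; rewrite -Et -Es !cmapK // => yts.
  have : t *: v + u = s *: v + u by rewrite -Et -Es yts.
  move=> /addIr/eqP; rewrite -subr_eq0 -scalerBl scaler_eq0 (negbTE vn0) orbF.
  by rewrite subr_eq0.
have /filter_ex[t [tD tA]] : \forall t \near (0 : R)^',
    ccod c (t *: v + u) /\ forall i, ccod c (t *: v + u) ->
      proj (cinv c (t *: v + u)) != p i.
  apply: filterI; first exact: nbhs_dnbhs.
  apply: (@filter_forall _ _ (fun i t => ccod c (t *: v + u) ->
    proj (cinv c (t *: v + u)) != p i) (0 : R)^') => i.
  exact: avoid.
have [yt ct Et] := tD.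
exists yt; last first.
  by move=> i; have := tA i tD; rewrite -Et cmapK.
apply/(slice yt ct).2; rewrite Et [LHS]mxE [X in X + _]mxE.
by rewrite v0 u0 mulr0 addr0.
Qed.

(** Otherwise dx_1 and dx_2 would both vanish on the three-dimensional tangent space at a regular
    point and so be proportional, against the surjectivity of dx. *)
Lemma hypersurface_off_axis (S : set X) : hypersurface S -> S !=set0 ->
  exists2 y, S y & 0 < axis2 (proj y).
Proof.
move=> hS S0; apply: contrapT => on_axis.
have ax y : S y -> proj y 0 0 = 0 /\ proj y 0 1 = 0.
  move=> Sy; have h0 := sqr_ge0 (proj y 0 0); have h1 := sqr_ge0 (proj y 0 1).
  have : ~ (0 < axis2 (proj y)) by move=> ?; apply: on_axis; exists y.
  move=> /negP; rewrite -leNgt => h.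
  have e0 : proj y 0 0 ^+ 2 = 0 by lra.
  have e1 : proj y 0 1 ^+ 2 = 0 by lra.
  by split; apply/eqP; rewrite -sqrf_eq0; apply/eqP.
have [y Sy reg] := hypersurface_regular_pt hS S0.
have [c [ac slice] cy] := hS y Sy.
pose x (z : 'rV[R]_4) := proj (cinv c z); pose u := cmap c y.
have xs : smooth_on (ccod c) x by exact: chart_proj_smooth.
have Du : ccod c u by exact: chart_ccod.
have nD : nbhs u (ccod c) by apply: open_nbhs_nbhs; split=> //; exact: open_ccod.
have u0 : u 0 ord_max = 0 by exact/(slice y cy).1.
pose J := jacobian x u.
have slice0 (w : 'rV[R]_4) (j : 'I_3) : w 0 ord_max = 0 ->
    (forall y, S y -> proj y 0 j = 0) -> (w *m J) 0 j = 0.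
  move=> w0 Sj; rewrite /J (jacobianE Du xs).
  apply: (line_max_derive (f := fun z => x z 0 j)
    (f1 := fun z => ('D_w x z) 0 j) (v := w)).
    by apply: filterS nD => z; exact: is_derive_smooth.
  apply: filterS (near_line w nD) => t [y' cy' E].
  rewrite /x -E /u !cmapK // !Sj //; apply/(slice y' cy').2.
  by rewrite E !mxE w0 u0 mulr0 addr0.
have JE (w : 'rV[R]_4) (j : 'I_3) : (forall y, S y -> proj y 0 j = 0) ->
    (w *m J) 0 j = w 0 ord_max * J ord_max j.
  move=> Sj; rewrite mxE (bigD1_ord ord_max) //= big1 ?addr0 // => b _.
  have /slice0/(_ Sj) : (delta_mx 0 (lift ord_max b) : 'rV[R]_4) 0 ord_max = 0.
    by rewrite mxE /= (negbTE (neq_lift _ _)).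
  by rewrite -rowE mxE => ->; rewrite mulr0.
have [L LE] := gh_lift (gh_metric_near ac cy reg) (gh_metric_pos ac cy).
have ax0 y' : S y' -> proj y' 0 0 = 0 by case/ax.
have ax1 y' : S y' -> proj y' 0 1 = 0 by case/ax.
(* The lifts of (1, 0, 0) and (0, 1, 0) would make (1, 0) and (0, 1) multiples of the same pair
   [J ord_max 0], [J ord_max 1]. *)
have [_ L0] := LE 0 (row3 1 0 0); have [_ L1] := LE 0 (row3 0 1 0).
have E00 := JE (L 0 (row3 1 0 0)) 0 ax0; rewrite /J L0 row3E in E00.
have E01 := JE (L 0 (row3 1 0 0)) 1 ax1; rewrite /J L0 row3E in E01.
have E11 := JE (L 0 (row3 0 1 0)) 1 ax1; rewrite /J L1 row3E in E11.
move/esym/eqP: E01; rewrite mulf_eq0 => /orP[] /eqP E.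
  by move: E00; rewrite E mul0r => /eqP; rewrite oner_eq0.
by move: E11; rewrite E mulr0 => /eqP; rewrite oner_eq0.
Qed.

Lemma compact_minimal_max (S : set X) : compact_minimal_hypersurface S ->
  exists y, [/\ S y, 0 < axis2 (proj y) &
    forall y', S y' -> axis2 (proj y') <= axis2 (proj y)].
Proof.
move=> [S0 cS [hS minS]].
have cf : continuous (fun y => axis2 (proj y)).
  move=> y; have [c ac cy] := atlas_cover y.
  have cj j : {for y, continuous (fun y => proj y 0 j)}.
    exact: (continuous_cvg _ (@coord_continuous _ _ _ 0 j _)
      (gh_proj_continuous ac cy)).
  by apply: cvgD; rewrite expr2; apply: cvgM; exact: cj.
have [y Sy ymax] := compact_EVT_max S0 cS (continuous_subspaceT cf).
rewrite inE in Sy.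
have {}ymax y' : S y' -> axis2 (proj y') <= axis2 (proj y).
  by move=> Sy'; apply: ymax; rewrite inE.
exists y; split=> //.
have [y' Sy' y'0] := hypersurface_off_axis hS S0.
exact: lt_le_trans (ymax _ Sy').
Qed.

End GHSpace.

Theorem theorem1p3 (R : realType) (k : nat) (p : 'I_k -> 'rV[R]_3) (m : R)
    (X : gh_space p m)
    (hX : multi_Eguchi_Hanson X \/ multi_Taub_NUT X) :
  (forall S : set X, compact_minimal_hypersurface S ->
     S `<=` gh_proj (g := X) @^-1`
              [set x | axis_dist x <= 2 * \big[Num.max/0]_i axis_dist (p i)])
  /\
  ~ (exists S : set X, compact_minimal_hypersurface S /\
       S `<=` gh_proj (g := X) @^-1`
              [set x | ((axis_dist x)%:E <
                 \big[Order.min/+oo]_(i | (0 < axis_dist (p i))%R)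
                    (axis_dist (p i))%:E)%E]).
Proof.
have horizontal (d : 'rV[R]_3) : d 0 0 ^+ 2 + d 0 1 ^+ 2 <= enorm d ^+ 2.
  rewrite sqr_sqrtr; last by apply: sumr_ge0 => j _; exact: sqr_ge0.
  by rewrite sum_ord3 lerDl sqr_ge0.
split=> [S cS y' Sy' | [S [cS Sin]]].
  have [y [Sy y0 ymax]] := compact_minimal_max cS.
  rewrite /= leNgt; apply/negP => far.
  (* A point of [S] outside the cylinder forces the maximum point [y] outside as well. *)
  have {}far i : 2 * axis_dist (p i) < axis_dist (gh_proj y).
    apply: le_lt_trans (lt_le_trans far _).
      by rewrite ler_pM2l //; exact: le_bigmax.
    by rewrite ler_wsqrtr // ymax.
  have reg : regular_pts p (gh_proj y).
    move=> i; apply/eqP => yi; have := far i.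
    by rewrite yi; have := sqrtr_ge0 (p i 0 0 ^+ 2 + p i 0 1 ^+ 2);
      rewrite -/(axis_dist _) => ? ?; lra.
  have [_ _ minS] := cS.
  apply: (minimal_max_not_mean_convex minS Sy reg ymax y0) => i /=.
set d := gh_proj y - p i.
  have E j : d 0 j = gh_proj y 0 j - p i 0 j by rewrite !mxE.
  have := horizontal d; rewrite !E => h.
  apply: lt_le_trans (cylinder_estimate_outer (far i)) _.
  by rewrite ler_pM2l.
have [y [Sy y0 ymax]] := compact_minimal_max cS.
(* If every [axis_dist (p i)] is 0, the minimum is its default [+oo] and this claim is vacuous; such
   indices fall under the case of equality in the inner estimate. *)
have near i : 0 < axis_dist (p i) -> axis_dist (gh_proj y) < axis_dist (p i).
  move=> pi0; rewrite -lte_fin; apply: lt_le_trans (Sin y Sy) _.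
  exact: bigmin_le_cond.
have reg : regular_pts p (gh_proj y).
  move=> i; apply/eqP => yi; have := near i; rewrite -yi ltxx.
  by rewrite sqrtr_gt0 => /(_ y0).
have [_ _ minS] := cS.
apply: (minimal_max_not_mean_convex minS Sy reg ymax y0) => i /=.
set d := gh_proj y - p i.
have E j : d 0 j = gh_proj y 0 j - p i 0 j by rewrite !mxE.
have := horizontal d; rewrite !E => h.
apply: le_lt_trans (cylinder_estimate_inner (near i)) _.
apply: le_lt_trans h _.
(* The inner estimate is not strict; strictness comes from the factor 2 and [d] being nonzero. *)
by rewrite mulr_natl mulr2n ltrDl exprn_gt0 // enorm_gt0 // subr_eq0.
Qed.
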